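(* Let $d\ge 2$ and let $\mu$ be a minimizer, over all Borel probability measures on $\mathbb{S}^{d-1}$, of the three-point $1$-frame energy $$I(\mu)=\int_{\mathbb{S}^{d-1}}\int_{\mathbb{S}^{d-1}}\int_{\mathbb{S}^{d-1}}\left|\langle x,y\rangle\langle x,z\rangle\langle y,z\rangle\right|\,d\mu(x)\,d\mu(y)\,d\mu(z).$$ Then the Hausdorff dimension of the support of $\mu$ is at most $d-2$.
   Context: $\mathbb{S}^{d-1}$ is the unit sphere of $\mathbb{R}^d$ and $\langle\cdot,\cdot\rangle$ the Euclidean inner product. *)

(* Defs.v *)
From HB Require Import structures.
From mathcomp Require Import all_boot all_order all_algebra.
From mathcomp Require Import all_classical all_reals all_analysis.
Set Implicit Arguments. Unset Strict Implicit. Unset Printing Implicit Defensive.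
Import Order.TTheory GRing.Theory Num.Theory.
Import numFieldNormedType.Exports.
Local Open Scope classical_set_scope.
Local Open Scope ring_scope.

Definition dotv {R : realType} {d : nat} (x y : 'rV[R]_d) : R :=
  \sum_(i < d) x ord0 i * y ord0 i.

Definition edist {R : realType} {d : nat} (x y : 'rV[R]_d) : R :=
  Num.sqrt (dotv (x - y) (x - y)).

Definition sphere (R : realType) (d : nat) : set 'rV[R]_d :=
  [set x | dotv x x = 1].

Definition borelRd (R : realType) (d : nat) :=
  g_sigma_algebraType (@open 'rV[R]_d).

Definition frame_energy (R : realType) (d : nat)
  (mu : probability (borelRd R d) R) : \bar R :=
  (\int[mu]_(x in @sphere R d) \int[mu]_(y in @sphere R d)
     \int[mu]_(z in @sphere R d)
       (`| dotv x y * dotv x z * dotv y z |)%:E)%E.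

(* Borel probability measure on S^{d-1}: probability on R^d concentrated on
   the sphere *)
Definition on_sphere (R : realType) (d : nat)
  (mu : probability (borelRd R d) R) : Prop :=
  mu (~` @sphere R d) = 0%E.

Definition msupport (R : realType) (d : nat)
  (mu : probability (borelRd R d) R) : set 'rV[R]_d :=
  [set x | forall U : set 'rV[R]_d, open U -> U x -> (0 < mu U)%E].

(* Euclidean diameter (sup of empty set is -oo) *)
Definition ediam (R : realType) (d : nat) (A : set 'rV[R]_d) : \bar R :=
  ereal_sup [set (edist x y)%:E | x in A & y in A].

Definition diam_pow (R : realType) (d : nat) (s : R) (A : set 'rV[R]_d) : \bar R :=
  if pselect (A = set0) then 0%E else ((fine (ediam A)) `^ s)%:E.

Definition hausdorff_content (R : realType) (d : nat) (s delta : R)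
  (A : set 'rV[R]_d) : \bar R :=
  ereal_inf [set (\sum_(0 <= i <oo) diam_pow s (F i))%E |
              F in [set F : nat -> set 'rV[R]_d |
                     A `<=` \bigcup_i F i /\
                     forall i, (ediam (F i) <= delta%:E)%E]].

(* s-dimensional Hausdorff outer measure: limit (= sup) as delta -> 0+ *)
Definition hausdorff_measure (R : realType) (d : nat) (s : R)
  (A : set 'rV[R]_d) : \bar R :=
  ereal_sup [set hausdorff_content s delta A | delta in [set delta : R | 0 < delta]].

Definition hausdorff_dim (R : realType) (d : nat) (A : set 'rV[R]_d) : \bar R :=
  ereal_inf [set s%:E | s in [set s : R | 0 <= s /\ hausdorff_measure s A = 0%E]].

(* Main.v *)
(** Since |t| >= t, the energy of mu is at least the triple integral of
    <x,y><x,z><y,z>, which is tr(A^3) for the moment matrix A of mu, and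
    tr(A^3) >= d^-2 because A is positive semidefinite with trace 1. An
    orthonormal basis attains d^-2, so for a minimizer A = I/d and
    <x,y><x,z><y,z> >= 0 on the support S.

    Every x in S is orthogonal to some y in S, and on a small piece of S the
    function <.,y> has constant sign. So each point w of the piece has a unit
    vector e(w) with <w,e(w)> = 0 and <w',e(w)> >= 0 for all w' in the piece: the
    piece lies in the boundary of a convex cone. If points w_i of it are
    1/n-separated, then so are the points a w_i - t e(w_i) with a - 1 and t in
    {0, 1/n, ..., (n-1)/n}; comparing with a grid in R^d gives O(n^(d-2)) for the
    number of w_i. *)
Require Import Defs.
From HB Require Import structures.
From mathcomp Require Import all_boot all_order all_algebra.
From mathcomp Require Import all_classical all_reals all_analysis measurable_realfun.
From mathcomp Require Import ring lra.
Import Order.TTheory GRing.Theory Num.Theory.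
Import numFieldNormedType.Exports.
Local Open Scope classical_set_scope.
Local Open Scope ring_scope.
Set Implicit Arguments.
Unset Strict Implicit.
Unset Printing Implicit Defensive.

(** * Inner product and sphere *)

Section InnerProduct.
Context {R : realType} {d : nat}.
Implicit Types x y z u v : 'rV[R]_d.

Lemma dotvC x y : dotv x y = dotv y x.
Proof. by apply: eq_bigr => i _; rewrite mulrC. Qed.

Lemma dotvDl x y z : dotv (x + y) z = dotv x z + dotv y z.
Proof. by rewrite /dotv -big_split; apply: eq_bigr => i _; rewrite mxE mulrDl. Qed.

Lemma dotvZl a x z : dotv (a *: x) z = a * dotv x z.
Proof. by rewrite /dotv mulr_sumr; apply: eq_bigr => i _; rewrite mxE mulrA. Qed.

Lemma dotvNl x z : dotv (- x) z = - dotv x z.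
Proof. by rewrite -scaleN1r dotvZl mulN1r. Qed.

Lemma dotvBl x y z : dotv (x - y) z = dotv x z - dotv y z.
Proof. by rewrite dotvDl dotvNl. Qed.

Lemma dotvDr x y z : dotv z (x + y) = dotv z x + dotv z y.
Proof. by rewrite dotvC dotvDl !(dotvC z). Qed.

Lemma dotvZr a x z : dotv z (a *: x) = a * dotv z x.
Proof. by rewrite dotvC dotvZl (dotvC z). Qed.

Lemma dotvBr x y z : dotv z (x - y) = dotv z x - dotv z y.
Proof. by rewrite dotvC dotvBl !(dotvC z). Qed.

Lemma dotv0r z : dotv z 0 = 0.
Proof. by rewrite -(scale0r z) dotvZr mul0r. Qed.

Lemma dotv_ge0 x : 0 <= dotv x x.
Proof. by apply: sumr_ge0 => i _; rewrite -expr2 sqr_ge0. Qed.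

Lemma coord_sqr_le x i : x ord0 i ^+ 2 <= dotv x x.
Proof.
rewrite /dotv (bigD1 i) //= -expr2 lerDl sumr_ge0 // => j _.
by rewrite -expr2 sqr_ge0.
Qed.

Lemma dotv_sqrB x y : dotv (x - y) (x - y) = dotv x x + dotv y y - 2 * dotv x y.
Proof. by rewrite !(dotvBl, dotvBr) (dotvC y x); ring. Qed.

Lemma dotv_sqrD x y : dotv (x + y) (x + y) = dotv x x + dotv y y + 2 * dotv x y.
Proof. by rewrite !(dotvDl, dotvDr) (dotvC y x); ring. Qed.

Lemma sphere_dotv_le1 x y : sphere x -> sphere y -> `|dotv x y| <= 1.
Proof.
rewrite /sphere /= => hx hy.
have := dotv_ge0 (x - y); have := dotv_ge0 (x + y).
rewrite dotv_sqrB dotv_sqrD hx hy ler_norml => h1 h2.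
by apply/andP; split; lra.
Qed.

Lemma sphere_coord_le1 x i : sphere x -> `|x ord0 i| <= 1.
Proof.
rewrite /sphere /= => hx; have := coord_sqr_le x i.
by rewrite hx -ler_sqrt ?ltr01 // sqrtr_sqr sqrtr1.
Qed.

Lemma continuous_dotv y : continuous (fun x : 'rV[R]_d => dotv x y).
Proof.
apply: continuous_big => [|i _ x]; first exact: add_continuous.
exact: (continuousM (@coord_continuous R _ _ _ _ x) (@cst_continuous _ _ _ x)).
Qed.

Lemma continuous_dotvv : continuous (fun x : 'rV[R]_d => dotv x x).
Proof.
apply: continuous_big => [|i _ x]; first exact: add_continuous.
exact: (continuousM (@coord_continuous R _ _ _ _ x) (@coord_continuous R _ _ _ _ x)).
Qed.

Lemma closed_sphere : closed (@sphere R d).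
Proof.
rewrite (_ : @sphere R d = (fun x : 'rV[R]_d => dotv x x) @^-1` [set 1]) //.
by apply: closed_comp => [x _|]; [exact: continuous_dotvv | exact: closed_eq].
Qed.

Lemma compact_sphere : compact (@sphere R d).
Proof.
have K := @rV_compact R d (fun=> `[-1, 1]%classic) (fun=> @segment_compact R _ _).
apply: subclosed_compact closed_sphere K _.
by move=> x /sphere_coord_le1 h i /=; rewrite in_itv /= -ler_norml h.
Qed.

End InnerProduct.

(** * Expectations over the sphere *)

Section Measurability.
Context {R : realType} {d : nat}.

Lemma measurable_open_borelRd (U : set 'rV[R]_d) :
  open U -> measurable (U : set (borelRd R d)).
Proof. by move=> oU; exact: sub_sigma_algebra. Qed.

Lemma measurable_sphere : measurable (@sphere R d : set (borelRd R d)).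
Proof.
rewrite -[X in measurable X]setCK; apply: measurableC.
by apply: measurable_open_borelRd; exact/closed_openC/closed_sphere.
Qed.

Lemma measurable_coord (i : 'I_d) :
  measurable_fun setT (fun x : borelRd R d => (x : 'rV[R]_d) ord0 i).
Proof.
apply: (measurability _ (RGenOpens.measurableE R)).
move=> _ [_ [a [b ->]] <-]; rewrite setTI; apply: measurable_open_borelRd.
by apply: open_comp => [x _|]; [exact: coord_continuous | exact: interval_open].
Qed.

Lemma measurable_dotv {d' : measure_display} {T : measurableType d'}
    (f g : T -> borelRd R d) :
  measurable_fun setT f -> measurable_fun setT g ->
  measurable_fun setT (fun t => dotv (f t : 'rV[R]_d) (g t)).
Proof.
move=> mf mg; apply: measurable_sum => i.
by apply: measurable_funM;
  [exact: (measurableT_comp (measurable_coord i) mf)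
  |exact: (measurableT_comp (measurable_coord i) mg)].
Qed.

End Measurability.

Section SphereExpectation.
Context {R : realType} {d : nat} (mu : probability (borelRd R d) R).
Hypothesis hmu : on_sphere mu.
Local Notation D := (@sphere R d).
Local Notation "\E_ x F" := (Rintegral mu D (fun x => F))
  (at level 36, x name, F at level 36).
Implicit Types (f g : 'rV[R]_d -> R).

Lemma mu_sphere : mu D = 1%E.
Proof.
have mD := @measurable_sphere R d.
have := probability_setC mu mD; rewrite hmu.
have : mu D \is a fin_num by exact: fin_num_measure.
by case: (mu D) => //= r _ /eqP; rewrite -EFinB eqe eq_sym subr_eq0 => /eqP ->.
Qed.

(** Bounded only over the sphere, since coordinates are unbounded on the whole space. As [mu] is
    finite this gives integrability, and the class is closed under sums and products. *)
Definition bmeas g := measurable_fun (D : set (borelRd R d)) g /\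
  exists C, forall x, D x -> `|g x| <= C.

Lemma bmeas_integrable g : bmeas g -> mu.-integrable D (EFin \o g).
Proof.
move=> [mg [C gC]]; apply: measurable_bounded_integrable => //.
- exact: measurable_sphere.
- exact: le_lt_trans (probability_le1 mu measurable_sphere) (ltry 1).
- by exists C; split => [|M CM x Dx];
    [exact: num_real | exact: le_trans (gC x Dx) (ltW CM)].
Qed.

Lemma bmeasD f g : bmeas f -> bmeas g -> bmeas (fun x => f x + g x).
Proof.
move=> [mf [A fA]] [mg [B gB]]; split; first exact: measurable_funD.
by exists (A + B) => x Dx; apply: le_trans (ler_normD _ _) (lerD (fA x Dx) (gB x Dx)).
Qed.

Lemma bmeasM f g : bmeas f -> bmeas g -> bmeas (fun x => f x * g x).
Proof.
move=> [mf [A fA]] [mg [B gB]]; split; first exact: measurable_funM.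
by exists (A * B) => x Dx; rewrite normrM ler_pM // ?fA ?gB.
Qed.

Lemma bmeas_cst c : bmeas (fun=> c).
Proof. by split; [exact: measurable_cst | exists `|c|]. Qed.

Lemma bmeas_norm g : bmeas g -> bmeas (fun x => `|g x|).
Proof.
move=> [mg [A gA]]; split; first exact: measurableT_comp.
by exists A => x Dx; rewrite normr_id gA.
Qed.

Lemma bmeas_coord i : bmeas (fun x => x ord0 i).
Proof.
split; first exact: measurable_funTS (measurable_coord i).
by exists 1 => x; exact: sphere_coord_le1.
Qed.

Lemma bmeas_sum (F : 'I_d -> 'rV[R]_d -> R) :
  (forall i, bmeas (F i)) -> bmeas (fun x => \sum_i F i x).
Proof.
move=> bF; elim: index_enum => [|i s ih].
  by under eq_fun do rewrite big_nil; exact: bmeas_cst.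
by under eq_fun do rewrite big_cons; exact: bmeasD.
Qed.

Lemma bmeas_dotv y : bmeas (dotv y).
Proof.
by apply: bmeas_sum => i; apply: bmeasM; [exact: bmeas_cst | exact: bmeas_coord].
Qed.

Lemma bmeas_dotvm (A : 'M[R]_d) : bmeas (fun x => dotv x (x *m A)).
Proof.
apply: bmeas_sum => i; apply: bmeasM; first exact: bmeas_coord.
under eq_fun do rewrite mxE; apply: bmeas_sum => j.
by apply: bmeasM; [exact: bmeas_coord | exact: bmeas_cst].
Qed.

Lemma E_add f g : bmeas f -> bmeas g -> \E_ x (f x + g x) = \E_ x (f x) + \E_ x (g x).
Proof.
move=> /bmeas_integrable ? /bmeas_integrable ?.
exact: RintegralD measurable_sphere _ _.
Qed.

Lemma E_scale c f : bmeas f -> \E_ x (c * f x) = c * \E_ x (f x).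
Proof. by move=> /bmeas_integrable ?; exact: RintegralZl measurable_sphere _. Qed.

Lemma E_cst c : \E_ x c = c.
Proof.
by rewrite (Rintegral_cst mu (@measurable_sphere R d)) [X in fine X]mu_sphere mulr1.
Qed.

Lemma E_sum (F : 'I_d -> 'rV[R]_d -> R) :
  (forall i, bmeas (F i)) -> \E_ x (\sum_i F i x) = \sum_i \E_ x (F i x).
Proof.
move=> bF; suff: forall s, bmeas (fun x => \sum_(i <- s) F i x) /\
    \E_ x (\sum_(i <- s) F i x) = \sum_(i <- s) \E_ x (F i x).
  by move=> /(_ (index_enum _))[].
elim=> [|i s [ih1 ih2]].
  under eq_fun do rewrite big_nil.
  by rewrite big_nil E_cst; split => //; exact: bmeas_cst.
under eq_fun do rewrite big_cons.
by rewrite big_cons E_add // ih2; split => //; exact: bmeasD.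
Qed.

Lemma le_E f g : bmeas f -> bmeas g -> (forall x, D x -> f x <= g x) ->
  \E_ x (f x) <= \E_ x (g x).
Proof.
move=> /bmeas_integrable ? /bmeas_integrable ?.
exact: le_Rintegral measurable_sphere _ _.
Qed.

Lemma eq_E f g : (forall x, D x -> f x = g x) -> \E_ x (f x) = \E_ x (g x).
Proof. by move=> fg; apply: eq_Rintegral => x /set_mem; exact: fg. Qed.

Lemma EFin_E g : bmeas g -> (\int[mu]_(x in D) (g x)%:E)%E = (\E_ x (g x))%:E.
Proof.
move=> /bmeas_integrable ig; rewrite /Rintegral fineK //.
by apply: integrable_fin_num => //; exact: measurable_sphere.
Qed.

Definition moment : 'M[R]_d := \matrix_(i, j) \E_ x (x ord0 i * x ord0 j).

(** Expand both inner products in coordinates. An integration thus trades two inner products for one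
    factor [moment], which is how the triple integral becomes tr(A^3). *)
Lemma E_dotv2 u v : \E_ x (dotv u x * dotv v x) = dotv u (v *m moment).
Proof.
have bc i : bmeas (fun x => x ord0 i * dotv v x).
  by apply: bmeasM; [exact: bmeas_coord | exact: bmeas_dotv].
transitivity (\sum_i u ord0 i * \E_ x (x ord0 i * dotv v x)).
  under [RHS]eq_bigr do rewrite -E_scale //.
  rewrite -E_sum; last by move=> i; apply: bmeasM => //; exact: bmeas_cst.
  by apply: eq_E => x _; rewrite {1}/dotv mulr_suml; apply: eq_bigr => i _; ring.
apply: eq_bigr => i _; congr (_ * _).
rewrite mxE; have bj j : bmeas (fun x => x ord0 j * x ord0 i).
  by apply: bmeasM; exact: bmeas_coord.
transitivity (\E_ x (\sum_j v ord0 j * (x ord0 j * x ord0 i))).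
  by apply: eq_E => x _; rewrite /dotv mulr_sumr; apply: eq_bigr => j _; ring.
rewrite E_sum; last by move=> j; apply: bmeasM => //; exact: bmeas_cst.
by apply: eq_bigr => j _; rewrite E_scale // mxE.
Qed.

End SphereExpectation.

(** * The energy and the moment matrix *)

Definition triple {R : realType} {d : nat} (x y z : 'rV[R]_d) : R :=
  dotv x y * dotv x z * dotv y z.

Lemma dotvE {R : realType} {d : nat} (x y : 'rV[R]_d) : dotv x y = (x *m y^T) ord0 ord0.
Proof. by rewrite mxE; apply: eq_bigr => i _; rewrite mxE. Qed.

Lemma dotv_mulmxr {R : realType} {d : nat} (x y : 'rV[R]_d) (A : 'M[R]_d) :
  dotv x (y *m A) = dotv (x *m A^T) y.
Proof. by rewrite !dotvE trmx_mul mulmxA. Qed.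

Section Energy.
Context {R : realType} {d : nat} (mu : probability (borelRd R d) R).
Hypothesis hmu : on_sphere mu.
Local Notation D := (@sphere R d).
Local Notation "\E_ x F" := (Rintegral mu D (fun x => F))
  (at level 36, x name, F at level 36).
Local Notation A := (moment mu).
Implicit Types (g : 'rV[R]_d -> R) (x y z : 'rV[R]_d) (B : 'M[R]_d).

(** Tonelli's theorem for a nonnegative integrand. Where the inner integral is infinite [fine] gives
    0, which preserves measurability. *)
Lemma measurable_E_section {d' : measure_display} {T : measurableType d'}
    (H : T * borelRd R d -> R) :
  measurable_fun setT H -> (forall p, 0 <= H p) ->
  measurable_fun setT (fun t => \E_ z (H (t, z))).
Proof.
move=> mH H0.
(* Tonelli integrates over the whole space, so the indicator carries the restriction to the
   sphere. *)
pose K (p : T * borelRd R d) := (H p * \1_D (p.2 : 'rV[R]_d))%:E.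
have mK : measurable_fun setT K.
  apply/measurable_EFinP; apply: measurable_funM => //.
  by apply: measurableT_comp => //; exact: measurable_indic measurable_sphere.
have K0 p : (0 <= K p)%E by rewrite lee_fin mulr_ge0.
have := measurableT_comp (@fine_measurable R setT measurableT)
  (@measurable_fun_fubini_tonelli_F _ _ _ _ _ mu _ mK K0).
apply: eq_measurable_fun => t _ /=; rewrite /Rintegral integral_mkcond.
congr fine; apply: eq_integral => z _.
by rewrite /K /= patchE indicE; case: ifP => _; rewrite ?mulr1 ?mulr0.
Qed.

Lemma E_bounded g : bmeas g -> (forall x, D x -> 0 <= g x <= 1) ->
  0 <= \E_ x (g x) <= 1.
Proof.
move=> bg h; apply/andP; split.
  by apply: Rintegral_ge0 => x /h /andP[].
rewrite -[X in _ <= X](E_cst hmu 1); apply: le_E => //; first exact: bmeas_cst.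
by move=> x /h /andP[].
Qed.

Lemma bmeas_unit g : measurable_fun (setT : set (borelRd R d)) g ->
  (forall x, D x -> 0 <= g x <= 1) -> bmeas g.
Proof.
move=> mg h; split; first exact: measurable_funTS.
by exists 1 => x /h /andP[g0 g1]; rewrite ger0_norm.
Qed.

Lemma bmeas_triple x y : bmeas (triple x y).
Proof.
by apply: bmeasM; [apply: bmeasM; [exact: bmeas_cst|] |]; exact: bmeas_dotv.
Qed.

Lemma triple_le1 x y z : D x -> D y -> D z -> 0 <= `|triple x y z| <= 1.
Proof.
move=> Dx Dy Dz; rewrite normr_ge0 /= !normrM.
by rewrite !mulr_ile1 ?mulr_ge0 ?sphere_dotv_le1.
Qed.

Lemma E_triple_le1 x y : D x -> D y -> 0 <= \E_ z `|triple x y z| <= 1.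
Proof.
move=> Dx Dy; apply: E_bounded; first exact: bmeas_norm (bmeas_triple x y).
by move=> z; exact: triple_le1.
Qed.

Lemma bmeas_E_triple x : D x -> bmeas (fun y => \E_ z `|triple x y z|).
Proof.
move=> Dx; apply: bmeas_unit; last by move=> y; exact: E_triple_le1.
apply: (@measurable_E_section _ (borelRd R d) (fun p => `|triple x p.1 p.2|)) => //.
apply: measurableT_comp => //; apply: measurable_funM; first apply: measurable_funM.
- by apply: measurable_dotv => //; exact: measurable_cst.
- by apply: measurable_dotv => //; exact: measurable_cst.
- by apply: measurable_dotv.
Qed.

Lemma bmeas_EE_triple : bmeas (fun x => \E_ y \E_ z `|triple x y z|).
Proof.
apply: bmeas_unit; last first.
  move=> x Dx; apply: E_bounded; first exact: bmeas_E_triple.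
  by move=> y; exact: E_triple_le1.
apply: (@measurable_E_section _ (borelRd R d)
  (fun p => \E_ z `|triple p.1 p.2 z|)); last first.
  by move=> p; apply: Rintegral_ge0.
apply: (@measurable_E_section _ (borelRd R d * borelRd R d)%type
  (fun p => `|triple p.1.1 p.1.2 p.2|)) => //.
apply: measurableT_comp => //; apply: measurable_funM; first apply: measurable_funM.
- by apply: measurable_dotv; apply: measurableT_comp.
- by apply: measurable_dotv => //; apply: measurableT_comp.
- by apply: measurable_dotv => //; apply: measurableT_comp.
Qed.

(** At all three levels the integrals stay in [0, 1], so [fine] loses nothing. *)
Lemma frame_energyE :
  frame_energy mu = (\E_ x \E_ y \E_ z `|triple x y z|)%:E.
Proof.
rewrite -EFin_E; last exact: bmeas_EE_triple.
apply: eq_integral => x /set_mem Dx.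
rewrite -EFin_E; last exact: bmeas_E_triple.
apply: eq_integral => y /set_mem Dy.
by rewrite -EFin_E //; exact: bmeas_norm (bmeas_triple x y).
Qed.

Lemma moment_sym : A^T = A.
Proof. by apply/matrixP => i j; rewrite !mxE; apply: eq_E => x _; rewrite mulrC. Qed.

Lemma E_triple x y : \E_ z (triple x y z) = dotv x y * dotv x (y *m A).
Proof.
rewrite -(E_dotv2 hmu) -E_scale.
  by apply: eq_E => z _; rewrite /triple mulrA.
by apply: bmeasM; exact: bmeas_dotv.
Qed.

Lemma bmeas_dotv_mulmx x B : bmeas (fun y => dotv x (y *m B)).
Proof.
have -> : (fun y => dotv x (y *m B)) = dotv (x *m B^T).
  by apply/funext => y; rewrite dotv_mulmxr.
exact: bmeas_dotv.
Qed.

(** The symmetry of A moves it across the product, and [E_dotv2] applies with second vector xA. The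
    expectation over x of the result is tr(A^3). *)
Lemma EE_triple x :
  \E_ y (dotv x y * dotv x (y *m A)) = dotv (x *m A) (x *m A).
Proof.
transitivity (\E_ y (dotv x y * dotv (x *m A) y)).
  by apply: eq_E => y _; rewrite [in RHS]dotvC dotv_mulmxr dotvC moment_sym.
by rewrite E_dotv2 // dotv_mulmxr moment_sym.
Qed.

Lemma E_dotv_mulmx B :
  \E_ x (dotv x (x *m B)) = \sum_i \sum_j B j i * A j i.
Proof.
have bij i j : bmeas (fun x : 'rV[R]_d => x ord0 j * x ord0 i).
  by apply: bmeasM; exact: bmeas_coord.
transitivity (\E_ x (\sum_i \sum_j B j i * (x ord0 j * x ord0 i))).
  apply: eq_E => x _; apply: eq_bigr => i _; rewrite mxE mulr_sumr.
  by apply: eq_bigr => j _; ring.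
rewrite E_sum //; last first.
  by move=> i; apply: bmeas_sum => j; apply: bmeasM => //; exact: bmeas_cst.
apply: eq_bigr => i _; rewrite E_sum //; last first.
  by move=> j; apply: bmeasM => //; exact: bmeas_cst.
by apply: eq_bigr => j _; rewrite E_scale // mxE.
Qed.

Lemma trace_moment : \sum_i A i i = 1.
Proof.
rewrite -[RHS](E_cst hmu); under eq_bigr do rewrite mxE.
rewrite -E_sum //; first by apply: eq_E => x; rewrite /sphere /= => <-.
by move=> i; apply: bmeasM; exact: bmeas_coord.
Qed.

Lemma bmeas_mulmx_coord B i : bmeas (fun x => (x *m B) ord0 i).
Proof.
under eq_fun do rewrite mxE; apply: bmeas_sum => j.
by apply: bmeasM; [exact: bmeas_coord | exact: bmeas_cst].
Qed.

Lemma bmeas_sqr_mulmx B : bmeas (fun x => dotv (x *m B) (x *m B)).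
Proof. by apply: bmeas_sum => i; apply: bmeasM; exact: bmeas_mulmx_coord. Qed.

Lemma le_E_triple x y :
  dotv x y * dotv x (y *m A) <= \E_ z `|triple x y z|.
Proof.
rewrite -E_triple; apply: le_E; first exact: bmeas_triple.
  exact: bmeas_norm (bmeas_triple x y).
by move=> z _; exact: ler_norm.
Qed.

Lemma bmeas_dotv_dotv_mulmx x B :
  bmeas (fun y => dotv x y * dotv x (y *m B)).
Proof. by apply: bmeasM; [exact: bmeas_dotv | exact: bmeas_dotv_mulmx]. Qed.

Lemma le_EE_triple x : D x ->
  dotv (x *m A) (x *m A) <= \E_ y \E_ z `|triple x y z|.
Proof.
move=> Dx; rewrite -EE_triple; apply: le_E; first exact: bmeas_dotv_dotv_mulmx.
  exact: bmeas_E_triple.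
by move=> y _; exact: le_E_triple.
Qed.

(* Writing A = B + I/d, |xA|^2 = |xB|^2 + (2/d)<x,xB> + |x|^2/d^2, where
   <x,xB> has expectation tr(AB) = |B|^2 because tr B = 0. *)
Lemma E_sqr_mulmx_moment : (0 < d)%N ->
  d%:R^-1 ^+ 2 + 2 * d%:R^-1 * (\sum_i \sum_j (A - d%:R^-1%:M) j i ^+ 2) <=
  \E_ x (dotv (x *m A) (x *m A)).
Proof.
move=> d0; set c := d%:R^-1; set B := A - c%:M.
have cd : d%:R * c = 1 :> R by rewrite divff // pnatr_eq0 -lt0n.
have AB x : x *m A = x *m B + c *: x.
  by rewrite mulmxBr mul_mx_scalar subrK.
have -> : c ^+ 2 + 2 * c * (\sum_i \sum_j B j i ^+ 2) =
    \E_ x (c ^+ 2 + 2 * c * dotv x (x *m B)).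
  have b1 := bmeas_dotvm B; have b2 := bmeasM (bmeas_cst (2 * c)) b1.
  rewrite (E_add mu (bmeas_cst _) b2) (E_cst hmu) (E_scale mu _ b1) E_dotv_mulmx.
  congr (_ + _ * _).
  have Bji j i : A j i = B j i + c * (j == i)%:R.
    by rewrite /B; move: A => M; rewrite !mxE mulr_natr subrK.
  have trB : \sum_i B i i = 0.
    have := trace_moment; under eq_bigr do rewrite Bji eqxx mulr1.
    by rewrite big_split sumr_const card_ord -mulr_natl cd /= => ?; lra.
  (* Since tr B = 0 the added diagonal terms cost nothing; they turn one factor B into A. *)
  transitivity (\sum_i (\sum_j B j i ^+ 2 + c * B i i)).
    by rewrite big_split /= -mulr_sumr trB mulr0 addr0.
  apply: eq_bigr => i _.
  transitivity (\sum_j (B j i ^+ 2 + (if j == i then c * B i i else 0))).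
    by rewrite big_split /= -big_mkcond big_pred1_eq.
  apply: eq_bigr => j _; rewrite Bji.
  by case: eqP => [->|_]; rewrite ?mulr1 ?mulr0 ?addr0; ring.
apply: le_E => //.
- apply: bmeasD; first exact: bmeas_cst.
  by apply: bmeasM; [exact: bmeas_cst | exact: bmeas_dotvm].
- exact: bmeas_sqr_mulmx.
move=> x; rewrite /sphere /= => Dx; rewrite AB dotv_sqrD !(dotvZl, dotvZr) Dx.
by have := dotv_ge0 (x *m B); rewrite (dotvC (x *m B) x); lra.
Qed.

(** The chain energy >= E|xA|^2 >= d^-2 + (2/d)|A - I/d|^2 >= d^-2 closes up under the hypothesis.
    So A - I/d vanishes, and passing from t to |t| in the energy gains nothing, which is the second
    conclusion. *)
Lemma isotropic_of_small_energy : (0 < d)%N ->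
  (frame_energy mu <= (d%:R^-1 ^+ 2)%:E)%E ->
  A = d%:R^-1%:M /\
  \E_ x \E_ y \E_ z `|triple x y z| <= \E_ x (dotv (x *m A) (x *m A)).
Proof.
move=> d0; rewrite frame_energyE lee_fin => le1.
have le2 := E_sqr_mulmx_moment d0.
have c0 : 0 < 2 * d%:R^-1 :> R by rewrite mulr_gt0 // invr_gt0 ltr0n.
have le3 : \E_ x (dotv (x *m A) (x *m A)) <= \E_ x \E_ y \E_ z `|triple x y z|.
  apply: le_E; first exact: bmeas_sqr_mulmx; first exact: bmeas_EE_triple.
  exact: le_EE_triple.
set S := \sum_i _ in le2.
have S0 : 0 <= S by do 2 (apply: sumr_ge0 => ? _); exact: sqr_ge0.
split; last first.
  by apply: le_trans le1 (le_trans _ le2); rewrite lerDl mulr_ge0 // ltW.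
have {S0} : S = 0.
  by apply/eqP; rewrite eq_le S0 andbT -(pmulr_rle0 _ c0); lra.
move=> /eqP; rewrite psumr_eq0; last by move=> i _; apply: sumr_ge0 => j _; exact: sqr_ge0.
move=> /allP h; apply/matrixP => j i; apply/eqP; rewrite -subr_eq0.
have := h i (mem_index_enum i) => /=.
rewrite psumr_eq0; last by move=> k _; exact: sqr_ge0.
by move=> /allP /(_ j (mem_index_enum j)) /=; rewrite sqrf_eq0 !mxE.
Qed.

End Energy.

(** * The competitor: uniform measure on an orthonormal basis *)

Section OrthonormalCompetitor.
Context {R : realType} {d : nat}.
Hypothesis d_gt0 : (0 < d)%N.
Local Notation D := (@sphere R d).

(** Indexed by [nat] to fit [msum]; the row is zero from index d on. *)
Let e (k : nat) : 'rV[R]_d := \row_j (j == k :> nat)%:R.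

Lemma dotv_basis (i j : 'I_d) : dotv (e i) (e j) = (i == j)%:R.
Proof.
rewrite /dotv (bigD1 i) //= big1 ?addr0.
  by rewrite !mxE eqxx mul1r.
by move=> k ki; rewrite !mxE (negPf ki : (k == i :> nat) = false) mul0r.
Qed.

(** A triple of basis vectors has nonzero product only when all three coincide, so the energy is d
    times d^-3. *)
Lemma exists_frame_energy_eq :
  exists nu : probability (borelRd R d) R,
    on_sphere nu /\ frame_energy nu = (d%:R^-1 ^+ 2)%:E.
Proof.
have d0 : 0 < d%:R :> R by rewrite ltr0n.
have c0 : 0 <= d%:R^-1 :> R by rewrite invr_ge0 ltW.
pose m : {measure set (borelRd R d) -> \bar R} :=
  mscale (NngNum c0) (msum (fun k => \d_(e k : borelRd R d)) d).
have mE (B : set (borelRd R d)) : m B = (d%:R^-1 * \sum_(k < d) \1_B (e k))%:E.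
  by rewrite /m /= /mscale /= /msum /= EFinM -sumEFin.
have m1 : m setT = 1%E.
  rewrite mE; congr EFin; under eq_bigr do rewrite indicT.
  by rewrite sumr_const card_ord mulVf // gt_eqF.
have [nu nuE] : exists nu : probability (borelRd R d) R, nu = m :> (set _ -> \bar R).
  (* [m] has mass 1, so [mnormalize] returns it unchanged as a probability; the Dirac mass is its
     fallback value. *)
  exists (mnormalize m (dirac (e 0%N : borelRd R d))); apply/funext => B.
  by rewrite /= /mnormalize m1 onee_eq0 /= invr1 mule1.
exists nu.
have nu_sphere : on_sphere nu.
  rewrite /on_sphere nuE mE big1 ?mulr0 // => k _.
  by rewrite indicE memNset //= => /(_ _); apply; rewrite /sphere /= dotv_basis eqxx.
split => //; rewrite frame_energyE //; congr EFin.
have nuint g : bmeas g -> (forall x, D x -> 0 <= g x) ->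
    \int[nu]_(x in D) g x = d%:R^-1 * \sum_(k < d) g (e k).
  move=> bg g0.
  have mg : measurable_fun (D : set (borelRd R d)) (EFin \o g).
    by apply/measurable_EFinP; case: bg.
  have mD := @measurable_sphere R d.
  rewrite /Rintegral (eq_measure_integral m); last by move=> B _ _; exact: (congr1 (@^~ B) nuE).
  rewrite ge0_integral_mscale // ge0_integral_measure_sum //.
  under eq_bigr do rewrite integral_dirac //.
  rewrite (eq_bigr (fun k : 'I_d => (g (e k))%:E)) => [|k _].
    by rewrite sumEFin -EFinM.
  by rewrite diracE mem_set ?mul1e //= /sphere /= dotv_basis eqxx.
have eD (k : 'I_d) : D (e k) by rewrite /sphere /= dotv_basis eqxx.
have inv0 : 0 <= d%:R^-1 :> R by [].
have Ez (i j : 'I_d) : \int[nu]_(z in D) `|triple (e i) (e j) z| = d%:R^-1 * (i == j)%:R.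
  rewrite nuint //; last exact: bmeas_norm (bmeas_triple _ _).
  congr (_ * _); rewrite (bigD1 i) //= big1 => [|k ki].
    by rewrite /triple !dotv_basis eqxx (eq_sym j) addr0; case: eqP => _;
      rewrite ?mulr1 ?mul0r ?normr0 ?normr1.
  by rewrite /triple !dotv_basis [i == k]eq_sym (negPf ki) mulr0 mul0r normr0.
have Ey (i : 'I_d) :
    \int[nu]_(y in D) \int[nu]_(z in D) `|triple (e i) y z| = d%:R^-1 ^+ 2.
  rewrite nuint; last by move=> y _; exact: Rintegral_ge0.
    rewrite (bigD1 i) //= big1 => [|k ki]; first by rewrite Ez eqxx mulr1 addr0.
    by rewrite Ez [i == k]eq_sym (negPf ki) mulr0.
  exact: bmeas_E_triple.
rewrite nuint; last by move=> x _; apply: Rintegral_ge0 => y _; exact: Rintegral_ge0.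
  rewrite (eq_bigr (fun=> d%:R^-1 ^+ 2)) => [|k _]; last exact: Ey.
  by rewrite sumr_const card_ord -[_ ^+ 2 *+ d]mulr_natl mulrA mulVf ?mul1r // gt_eqF.
exact: bmeas_EE_triple.
Qed.

End OrthonormalCompetitor.

(** * Support of a measure and almost-everywhere arguments *)

Section Support.
Context {R : realType} {d : nat} (mu : probability (borelRd R d) R).
Hypothesis hmu : on_sphere mu.
Local Notation D := (@sphere R d).
Local Notation S := (msupport mu).
Local Notation "\E_ x F" := (Rintegral mu D (fun x => F))
  (at level 36, x name, F at level 36).
Implicit Types (f g : 'rV[R]_d -> R) (x y z : 'rV[R]_d) (U K : set 'rV[R]_d).

Lemma msupport_sphere x : S x -> D x.
Proof.
move=> Sx; apply: contrapT => Dx.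
by have := Sx _ (closed_openC closed_sphere) Dx; rewrite hmu ltxx.
Qed.

Lemma closed_msupport : closed S.
Proof.
rewrite -[S]setCK; apply: open_closedC; rewrite openE => x.
move=> /existsNP[U /not_implyP[oU /not_implyP[Ux muU]]].
apply: (filterS _ (open_nbhs_nbhs (conj oU Ux))) => y Uy Sy.
exact/muU/Sy.
Qed.

Lemma compact_msupport : compact S.
Proof.
exact: (subclosed_compact closed_msupport compact_sphere msupport_sphere).
Qed.

(** Points off the support have null open neighbourhoods, and by compactness finitely many of them
    cover K. *)
Lemma compact_null K : compact K -> (forall x, K x -> ~ S x) ->
  mu.-negligible (K : set (borelRd R d)).
Proof.
rewrite compact_cover => Kc KS.
have h (x : 'rV[R]_d) : exists U, open U /\ (K x -> U x) /\ mu U = 0%E.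
  have [Kx|nKx] := pselect (K x); last first.
    by exists set0; split; [exact: open0 | split => //; exact: measure0].
  have /existsNP[U /not_implyP[oU /not_implyP[Ux muU]]] := KS x Kx.
  exists U; split => //; split => //; apply/eqP; rewrite eq_le measure_ge0 andbT.
  by rewrite leNgt; exact/negP.
have [F hF] := choice h.
have [|X _ KX] := Kc _ setT F (fun x _ => (hF x).1).
  by move=> x Kx; exists x => //; exact: (hF x).2.1.
apply: (@negligibleS _ (borelRd R d) R mu _ _ KX); rewrite /cover bigcup_fset.
apply: (big_ind (fun V : set 'rV[R]_d => mu.-negligible (V : set (borelRd R d)))).
- exact: negligible_set0.
- by move=> V W; exact: negligibleU.
- move=> x _; exists (F x); have [oF [_ F0]] := hF x; split => //.
  exact: measurable_open_borelRd.
Qed.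

(** The set is a countable union of compact pieces where g <= -1/(n+1), each disjoint from the
    support. *)
Lemma msupport_ae g : continuous g -> (forall x, S x -> 0 <= g x) ->
  mu.-negligible ([set x | D x /\ g x < 0] : set (borelRd R d)).
Proof.
move=> cg g0.
have sub : [set x | D x /\ g x < 0] `<=`
    \bigcup_n (D `&` (g @^-1` [set t | t <= - n.+1%:R^-1])).
  move=> x [Dx gx]; have [n ltn] := ltr_add_invr gx.
  exists n => //; split => //=; apply: ltW.
  by rewrite -(ltrD2r n.+1%:R^-1) addNr.
apply: (@negligibleS _ (borelRd R d) R mu _ _ sub); apply: negligible_bigcup => n.
apply: compact_null.
  apply: (subclosed_compact _ compact_sphere) => [|x []//].
  apply: closedI; first exact: closed_sphere.
  by apply: closed_comp => [x _|]; [exact: cg | exact: closed_le].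
by move=> x [_ /= gx] /g0; apply/negP; rewrite -ltNge (le_lt_trans gx) // oppr_lt0.
Qed.

Lemma E_ge0_msupport g : continuous g -> bmeas g ->
  (forall x, S x -> 0 <= g x) -> 0 <= \E_ x (g x).
Proof.
move=> cg bg g0; have [N [mN N0 sN]] := msupport_ae cg g0.
rewrite /Rintegral (@ae_eq_integral _ _ _ mu D (fun x => `|g x|%:E)).
- by apply: fine_ge0; apply: integral_ge0.
- exact: measurable_sphere.
- by apply/measurable_EFinP; case: bg.
- by apply/measurable_EFinP; case: (bmeas_norm bg).
exists N; split => // x /= /not_implyP[Dx gx]; apply: sN; split => //.
by rewrite ltNge; apply/negP => g0x; apply: gx; rewrite ger0_norm.
Qed.

(* U meets the support, hence has positive measure, while f = g almost
   everywhere on the sphere. *)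
Lemma eq_point_of_le_E f g U x0 : bmeas f -> bmeas g ->
  (forall x, D x -> g x <= f x) -> \E_ x (f x) <= \E_ x (g x) ->
  open U -> U x0 -> S x0 -> exists x, [/\ U x, D x & f x = g x].
Proof.
move=> bf bg gf Efg oU Ux0 Sx0; apply: contrapT => /forallNP H.
have bNg : bmeas (fun x => -1 * g x) by apply: bmeasM => //; exact: bmeas_cst.
have bh := bmeasD bf bNg.
(* The difference f - g is nonnegative on the sphere and has expectation 0. *)
have : ae_eq mu D (EFin \o (fun x => f x + -1 * g x)) (cst 0%E).
  apply/ae_eq_integral_abs; first exact: measurable_sphere.
    by apply/measurable_EFinP; case: bh.
  transitivity (\int[mu]_(x in D) (f x + -1 * g x)%:E)%E.
    apply: eq_integral => x /set_mem Dx /=; rewrite ger0_norm //.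
    by have := gf x Dx; lra.
  rewrite EFin_E // E_add // E_scale //; congr EFin; apply/eqP; rewrite eq_le.
  have := le_E mu bg bf gf.
  by move=> ?; apply/andP; split; lra.
move=> [N [mN N0 sN]].
have UN : U `<=` N `|` ~` D.
  move=> x Ux; have [Dx|] := pselect (D x); last by right.
  left; apply: sN => /= /(_ Dx) [] fg; apply: (H x); split => //; lra.
have := Sx0 _ oU Ux0; rewrite ltNge => /negP; apply.
have mC : measurable (~` D : set (borelRd R d)) by exact: measurableC (@measurable_sphere R d).
have mU := measurable_open_borelRd oU.
rewrite -(null_set_setU mN mC N0 hmu).
by apply: le_measure => //; rewrite inE //; exact: measurableU.
Qed.

End Support.

(** * The support of a minimizer *)

Section Minimizer.
Context {R : realType} {d : nat} (mu : probability (borelRd R d) R).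
Hypothesis d_gt1 : (1 < d)%N.
Hypothesis hmu : on_sphere mu.
Hypothesis small : (frame_energy mu <= (d%:R^-1 ^+ 2)%:E)%E.
Local Notation D := (@sphere R d).
Local Notation S := (msupport mu).
Local Notation A := (moment mu).
Local Notation "\E_ x F" := (Rintegral mu D (fun x => F))
  (at level 36, x name, F at level 36).
Implicit Types (x y z u v : 'rV[R]_d).

Let d_gt0 : (0 < d)%N := ltnW d_gt1.

Lemma E_dotv_isotropic u v : \E_ x (dotv u x * dotv v x) = d%:R^-1 * dotv u v.
Proof.
have [AE _] := isotropic_of_small_energy hmu d_gt0 small.
by rewrite E_dotv2 // AE mul_mx_scalar dotvZr.
Qed.

Lemma tripleCl x y z : triple x y z = triple y x z.
Proof. by rewrite /triple (dotvC y x); ring. Qed.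

Lemma tripleCr x y z : triple x y z = triple x z y.
Proof. by rewrite /triple (dotvC z y); ring. Qed.

Lemma open_triple_lt0 y z : open [set x | triple x y z < 0].
Proof.
rewrite (_ : mkset _ = (fun x => triple x y z) @^-1` [set t | t < 0]) //.
apply: open_comp => [x _|]; last exact: open_lt.
exact: (continuousM (continuousM (@continuous_dotv _ _ y x)
  (@continuous_dotv _ _ z x)) (@cst_continuous _ _ _ x)).
Qed.

(** Negativity of the product t is an open condition in each variable, so [eq_point_of_le_E] can
    move x, y, z one after another, keeping t < 0, to points where |t| and t have equal expectation
    over the remaining variables. After the last move |t| = t < 0. *)
Lemma msupport_triple_ge0 x y z : S x -> S y -> S z -> 0 <= triple x y z.
Proof.
move=> Sx Sy Sz; rewrite leNgt; apply/negP => neg.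
have [_ leE] := isotropic_of_small_energy hmu d_gt0 small.
have [x1 [neg1 Dx1 eq1]] := eq_point_of_le_E hmu (bmeas_EE_triple hmu)
  (bmeas_sqr_mulmx A) (le_EE_triple hmu) leE (@open_triple_lt0 y z) neg Sx.
have E1le : \E_ y \E_ z `|triple x1 y z| <= \E_ y (dotv x1 y * dotv x1 (y *m A)).
  by rewrite EE_triple // eq1.
rewrite /= tripleCl in neg1.
have [y1 [neg2 Dy1 eq2]] := eq_point_of_le_E hmu (bmeas_E_triple hmu Dx1)
  (bmeas_dotv_dotv_mulmx x1 A) (fun y _ => le_E_triple hmu x1 y)
  E1le (@open_triple_lt0 x1 z) neg1 Sy.
have E2le : \E_ z `|triple x1 y1 z| <= \E_ z triple x1 y1 z by rewrite E_triple // eq2.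
rewrite /= tripleCl tripleCr tripleCl in neg2.
have [z1 [neg3 Dz1 eq3]] := eq_point_of_le_E hmu
  (bmeas_norm (bmeas_triple x1 y1)) (bmeas_triple x1 y1)
  (fun z _ => ler_norm (triple x1 y1 z))
  E2le (@open_triple_lt0 x1 y1) neg2 Sz.
rewrite /= tripleCl tripleCr in neg3.
by have := normr_ge0 (triple x1 y1 z1); rewrite eq3 leNgt neg3.
Qed.

Lemma continuous_dotv2 u v : continuous (fun y => dotv u y * dotv v y).
Proof.
rewrite (_ : (fun y => _) = (fun y => dotv y u * dotv y v)).
  move=> y; exact: (continuousM (@continuous_dotv _ _ u y) (@continuous_dotv _ _ v y)).
by apply/funext => y; rewrite dotvC (dotvC v).
Qed.

Lemma continuous_norm_dotv u : continuous (fun y => `|dotv u y|).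
Proof.
rewrite (_ : (fun y => _) = (fun y => `|dotv y u|)).
  move=> y; apply: (continuous_comp (@continuous_dotv _ _ u y)).
  exact: norm_continuous.
by apply/funext => y; rewrite dotvC.
Qed.

(* If no point of S is orthogonal to x, let u in S minimize m = |<x,u>| > 0.
   Since <x,u><x,y><u,y> >= 0 on S, isotropy gives
   m = d E|<u,y><x,y>| >= m d E|<u,y>|, so E|<u,y>| <= 1/d = E<u,y>^2 and
   |<u,y>| is 0 or 1 on S. With y = x this forces m = 1, so |<x,y>| = 1 on S,
   contradicting E<x,y>^2 = 1/d. *)
Lemma exists_msupport_orthogonal x : S x -> exists2 z, S z & dotv x z = 0.
Proof.
move=> Sx; apply: contrapT => no.
have nz y : S y -> dotv x y != 0 by move=> Sy; apply/eqP => xy0; apply: no; exists y.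
have Dx : dotv x x = 1 := msupport_sphere hmu Sx.
have [u /set_mem Su umin] : exists2 u, u \in S &
    forall y, y \in S -> `|dotv x u| <= `|dotv x y|.
  apply: EVT_min_rV; [by exists x | exact: compact_msupport |].
  exact: (@continuous_subspaceT _ _ _ _ (@continuous_norm_dotv x)).
have Du : dotv u u = 1 := msupport_sphere hmu Su.
set m := `|dotv x u| in umin.
have m_gt0 : 0 < m by rewrite normr_gt0 nz.
have m2 : dotv x u * dotv x u = m ^+ 2 by rewrite -expr2 real_normK ?num_real.
have bn v : bmeas (fun y => `|dotv v y|) by exact: bmeas_norm (bmeas_dotv v).
have bp v w : bmeas (fun y => dotv v y * dotv w y) by apply: bmeasM; exact: bmeas_dotv.
have bc c f : bmeas f -> bmeas (fun y => c * f y) by move=> ?; apply: bmeasM => //; exact: bmeas_cst.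
(* On S the first product is nonnegative, hence equal to m |<x,y>| |<u,y>|, which is at least m^2
   |<u,y>| by the choice of u. *)
have le1 : 0 <= \E_ y (dotv x u * (dotv x y * dotv u y) + - m ^+ 2 * `|dotv u y|).
  apply: E_ge0_msupport => // [||y Sy].
  - move=> y; exact: (continuousD
      (continuousM (@cst_continuous _ _ _ y) (@continuous_dotv2 x u y))
      (continuousM (@cst_continuous _ _ _ y) (@continuous_norm_dotv u y))).
  - by apply: bmeasD; exact: bc.
  - have t0 : 0 <= dotv x u * (dotv x y * dotv u y).
      by rewrite mulrA; exact: msupport_triple_ge0.
    rewrite -(ger0_norm t0) !normrM -/m mulNr subr_ge0 expr2 -!mulrA.
    rewrite ler_pM2l // ler_wpM2r //; apply: umin; exact: mem_set.
rewrite (E_add mu (bc _ _ (bp _ _)) (bc _ _ (bn _))) !E_scale // E_dotv_isotropic in le1.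
rewrite mulrCA m2 in le1.
(* Isotropy turns [le1] into m^2 E|<u,y>| <= m^2/d, and 1/d is E<u,y>^2. *)
have le2 : \E_ y `|dotv u y| <= \E_ y (dotv u y * dotv u y).
  rewrite E_dotv_isotropic Du mulr1 -(ler_pM2l (exprn_gt0 2 m_gt0)).
  by rewrite [m ^+ 2 * d%:R^-1]mulrC; lra.
have sq_le y : D y -> dotv u y * dotv u y <= `|dotv u y|.
  move=> Dy; rewrite -expr2 -real_normK ?num_real // expr2 ler_piMl //.
  exact: sphere_dotv_le1.
have le_sq y : S y -> `|dotv u y| <= dotv u y * dotv u y.
  move=> Sy; rewrite leNgt; apply/negP => lt.
  (* A strict gap is an open condition, so its set would contain a point of equality. *)
  have oU : open [set y | dotv u y * dotv u y - `|dotv u y| < 0].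
    rewrite (_ : mkset _ =
      (fun y => dotv u y * dotv u y - `|dotv u y|) @^-1` [set t | t < 0]) //.
    apply: open_comp => [z _|]; last exact: open_lt.
    exact: (continuousB (@continuous_dotv2 u u z) (@continuous_norm_dotv u z)).
  have [|z [/= lt2 _ eq]] := eq_point_of_le_E hmu (bn u) (bp u u) sq_le le2 oU _ Sy.
    by rewrite /= subr_lt0.
  by move: lt2; rewrite eq subrr ltxx.
(* At x, [le_sq] reads m <= m^2. *)
have m1 : 1 <= m.
  by have := le_sq x Sx; rewrite (dotvC u) m2 expr2 -[X in X <= _]mulr1 ler_pM2l.
have : 0 <= \E_ y (dotv x y * dotv x y + -1).
  apply: E_ge0_msupport => [||y Sy].
  - move=> y; exact: (continuousD (@continuous_dotv2 x x y) (@cst_continuous _ _ _ y)).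
  - by apply: bmeasD => //; exact: bmeas_cst.
  - have : 1 <= `|dotv x y| by apply: (le_trans m1); apply: umin; exact: mem_set.
    by rewrite -expr2 -[dotv x y ^+ 2]real_normK ?num_real // => h; nra.
rewrite (E_add mu (bp _ _) (bmeas_cst _)) E_cst // E_dotv_isotropic Dx mulr1.
have lt1 : d%:R^-1 < 1 :> R by rewrite invf_lt1 ?ltr1n // ltr0n.
by move=> ?; lra.
Qed.

End Minimizer.

(** * Counting separated points *)

Section Grid.
Context {R : realType} {d : nat}.
Implicit Types (p q : 'rV[R]_d) (m : nat).

(** Cells of side 1/m on the cube [-3, 3]^d, which holds (1 + k/n) w - (l/n) e for unit vectors w, e
    and k, l < n. The last index 6m is for the endpoint 3. *)
Definition grid_cell m p : {ffun 'I_d -> 'I_(6 * m).+1} :=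
  [ffun i => inord (Num.truncn ((p ord0 i + 3) * m%:R))].

Lemma grid_cell_close m p q :
  (forall i, `|p ord0 i| <= 3) -> (forall i, `|q ord0 i| <= 3) ->
  grid_cell m p = grid_cell m q -> m%:R ^+ 2 * dotv (p - q) (p - q) <= d%:R.
Proof.
move=> hp hq /ffunP pq.
have bound (v : 'rV[R]_d) i : (forall i, `|v ord0 i| <= 3) ->
    0 <= (v ord0 i + 3) * m%:R <= (6 * m)%:R.
  move=> /(_ i); rewrite ler_norml => /andP[v1 v2].
  by rewrite natrM mulr_ge0 ?ler_wpM2r //=; lra.
have coord i : (m%:R * (p ord0 i - q ord0 i)) ^+ 2 <= 1.
  have /andP[p0 p6] := bound p i hp; have /andP[q0 q6] := bound q i hq.
  have /andP[tp1 tp2] := truncn_itv p0; have /andP[tq1 tq2] := truncn_itv q0.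
  (* [inord] is faithful only below [(6 * m).+1]. *)
  have small (t : R) : t <= (6 * m)%:R -> 0 <= t -> (Num.truncn t < (6 * m).+1)%N.
    move=> t6 t0; rewrite ltnS -(ler_nat R); apply: le_trans t6.
    by have /andP[] := truncn_itv t0.
  have e := pq i; rewrite !ffunE in e.
  have {e} := congr1 (@nat_of_ord _) e; rewrite !inordK ?small // => e.
  rewrite -[(Num.truncn _).+1%:R]natr1 e in tp2; rewrite e in tp1.
  rewrite -[(Num.truncn _).+1%:R]natr1 in tq2.
  have : -1 <= m%:R * (p ord0 i - q ord0 i) <= 1 by apply/andP; split; lra.
  by rewrite -ler_norml -[_ ^+ 2]real_normK ?num_real // expr_le1.
rewrite /dotv mulr_sumr; apply: (@le_trans _ _ (\sum_(i < d) 1)).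
  by apply: ler_sum => i _; rewrite !mxE -expr2 -exprMn.
by rewrite sumr_const card_ord.
Qed.

End Grid.

(** * Supporting vectors and the cardinality bound *)

Section SeparatedFamilies.
Context {R : realType} {d : nat} (S : set 'rV[R]_d).
Hypothesis d_gt1 : (1 < d)%N.
Hypothesis S_sphere : forall x, S x -> sphere x.
Hypothesis S_triple : forall x y z, S x -> S y -> S z -> 0 <= triple x y z.
Hypothesis S_orthogonal : forall x, S x -> exists2 z, S z & dotv x z = 0.
Implicit Types (v w : 'rV[R]_d).

Let d_gt0 : 0 < d%:R :> R.
Proof. by rewrite ltr0n ltnW. Qed.

Lemma sphere_grid_coord w i : sphere w -> `|w ord0 i| <= 3.
Proof. by move=> /(sphere_coord_le1 i) /le_trans; apply; rewrite ler1n. Qed.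

(** Mesh 1/d gives |v - w|^2 <= 1/d < 2, whereas unit vectors with nonpositive product are at
    squared distance at least 2. *)
Lemma same_cell_dotv_gt0 v w : S v -> S w ->
  grid_cell d v = grid_cell d w -> 0 < dotv v w.
Proof.
move=> /S_sphere Sv /S_sphere Sw /grid_cell_close.
move=> /(_ (fun i => sphere_grid_coord i Sv) (fun i => sphere_grid_coord i Sw)).
rewrite dotv_sqrB Sv Sw => h.
have d2 : 2 <= d%:R :> R by rewrite ler_nat.
rewrite ltNge; apply/negP => vw0.
have : d%:R ^+ 2 * 2 <= d%:R :> R by apply: le_trans h; rewrite ler_pM2l ?exprn_gt0 //; lra.
by nra.
Qed.

(* On a grid cell all points of S are pairwise non-orthogonal, so
   <y,w><y,w'> >= 0 for every y in S: the hyperplane normal to y does not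
   separate the cell, and y can be oriented towards it. *)
Lemma exists_supporting : exists eta : 'rV[R]_d -> 'rV[R]_d,
  forall w, S w -> [/\ sphere (eta w), dotv w (eta w) = 0 &
    forall v, S v -> grid_cell d v = grid_cell d w -> 0 <= dotv v (eta w)].
Proof.
suff h w : exists e, S w -> [/\ sphere e, dotv w e = 0 &
    forall v, S v -> grid_cell d v = grid_cell d w -> 0 <= dotv v e].
  by have [eta ?] := choice h; exists eta.
have [Sw|nSw] := pselect (S w); last by exists 0.
have [y Sy wy] := S_orthogonal Sw.
have [[u [Su uw yu]]|no] := pselect (exists u,
    [/\ S u, grid_cell d u = grid_cell d w & dotv u y < 0]); last first.
  exists y => _; split => // [|v Sv vw]; first exact: S_sphere.
  by rewrite leNgt; apply/negP => vy; apply: no; exists v.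
exists (- y) => _; rewrite -scaleN1r; split.
- by have := S_sphere Sy; rewrite /sphere /= dotvZl dotvZr => ->; ring.
- by rewrite dotvZr wy mulr0.
move=> v Sv vw; rewrite dotvZr.
have uv := same_cell_dotv_gt0 Su Sv (etrans uw (esym vw)).
(* In <u,v><u,y><v,y> >= 0 the first factor is positive and the second negative, so <v,y> <= 0. *)
have := S_triple Su Sv Sy; rewrite /triple -mulrA pmulr_rge0 // nmulr_rge0 //.
by rewrite mulN1r oppr_ge0.
Qed.

Lemma natr_sqr_sub_ge1 (i j : nat) : i != j -> 1 <= (i%:R - j%:R) ^+ 2 :> R.
Proof.
rewrite neq_ltn => /orP[] h.
  have : i%:R + 1 <= j%:R :> R by rewrite natr1 ler_nat.
  by nra.
have : j%:R + 1 <= i%:R :> R by rewrite natr1 ler_nat.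
by nra.
Qed.

(** The right side splits into |a w - a' w'|^2 = (a - a')^2 + 2 a a' (1 - <w,w'>), at least |w -
    w'|^2 as a a' >= 1, plus |t e - t' e'|^2, plus the cross terms 2 a t' <w,e'> + 2 a' t <w',e>,
    nonnegative by the support conditions. *)
Lemma supporting_dist (w w' e e' : 'rV[R]_d) (a a' t t' : R) :
  sphere w -> sphere w' -> sphere e -> sphere e' ->
  dotv w e = 0 -> dotv w' e' = 0 -> 0 <= dotv w e' -> 0 <= dotv w' e ->
  1 <= a -> 1 <= a' -> 0 <= t -> 0 <= t' ->
  dotv (w - w') (w - w') <=
    dotv ((a *: w - t *: e) - (a' *: w' - t' *: e'))
         ((a *: w - t *: e) - (a' *: w' - t' *: e')).
Proof.
rewrite /sphere /= => ww ww' ee ee' we we' we1 we2 a1 a1' t0 t0'.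
have := dotv_ge0 (t *: e - t' *: e').
rewrite !(dotvBl, dotvBr, dotvZl, dotvZr) (dotvC w' w) (dotvC e' e).
rewrite (dotvC e w) (dotvC e w') (dotvC e' w) (dotvC e' w').
rewrite ww ww' ee ee' we we' => h.
have ww1 : dotv w w' <= 1.
  by have := dotv_ge0 (w - w'); rewrite dotv_sqrB ww ww'; lra.
have h1 : 0 <= a * (t' * dotv w e') by rewrite !mulr_ge0 //; lra.
have h2 : 0 <= a' * (t * dotv w' e) by rewrite !mulr_ge0 //; lra.
have h3 : (1 - dotv w w') <= a * a' * (1 - dotv w w').
  by rewrite -[X in X <= _]mul1r ler_wpM2r ?subr_ge0 //; nra.
have h4 := sqr_ge0 (a - a').
by nra.
Qed.

(* The map (i, k, l) |-> (cell of w_i, fine cell of (1 + k/n) w_i - (l/n) eta_i)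
   is injective: inside a coarse cell these N n^2 points are 1/n-separated. *)
Lemma separated_card (n N : nat) (w : 'I_N -> 'rV[R]_d) : (0 < n)%N ->
  (forall i, S (w i)) ->
  (forall i j, i != j -> 1 <= n%:R ^+ 2 * dotv (w i - w j) (w i - w j)) ->
  (N * n ^ 2 <= ((6 * d).+1 * (7 * d)) ^ d * n ^ d)%N.
Proof.
move=> n_gt0 Sw sep; have [eta etaP] := exists_supporting.
have n0 : 0 < n%:R :> R by rewrite ltr0n.
pose pt (i : 'I_N) (k l : 'I_n) : 'rV[R]_d :=
  (1 + k%:R / n%:R) *: w i - (l%:R / n%:R) *: eta (w i).
have frac (k : 'I_n) : 0 <= (k%:R / n%:R : R) <= 1.
  by rewrite divr_ge0 //= ler_pdivrMr // mul1r ler_nat ltnW.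
have pt3 i k l c : `|pt i k l ord0 c| <= 3.
  have [Se _ _] := etaP _ (Sw i).
  have /andP[k0 k1] := frac k; have /andP[l0 l1] := frac l.
  have := sphere_coord_le1 c Se; have := sphere_coord_le1 c (S_sphere (Sw i)).
  rewrite !mxE !ler_norml => /andP[w1 w2] /andP[e1 e2].
  by apply/andP; split; nra.
pose T (p : 'I_N * ('I_n * 'I_n)) :=
  (grid_cell d (w p.1), grid_cell (d * n) (pt p.1 p.2.1 p.2.2)).
suff Tinj : injective T.
  have := leq_card T Tinj.
  rewrite !card_prod !card_ffun !card_ord -mulnn => /leq_trans; apply.
  rewrite expnMn -mulnA leq_mul2l -expnMn leq_exp2r ?(ltnW d_gt1) //.
  (* 6dn + 1 <= 7dn because dn >= 1. *)
  apply/orP; right; rewrite mulnA -addn1 -[(7 * d)%N]/((6 + 1) * d)%N mulnDl mul1n mulnDl.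
  by rewrite leq_add2l muln_gt0 (ltnW d_gt1).
move=> [i [k l]] [j [k' l']] [] /= cell_ij cell_pt.
have close := grid_cell_close (pt3 i k l) (pt3 j k' l') cell_pt.
have [Sei oi ci] := etaP _ (Sw i); have [Sej oj cj] := etaP _ (Sw j).
(* The fine mesh 1/(dn) bounds the squared distance by d/(dn)^2, and 1/d < 1. *)
have {close} close : n%:R ^+ 2 * dotv (pt i k l - pt j k' l') (pt i k l - pt j k' l') < 1.
  rewrite -(ltr_pM2l (_ : 0 < d%:R ^+ 2)) ?exprn_gt0 // mulr1 mulrA -exprMn -natrM.
  apply: le_lt_trans close _; rewrite expr2 -natrM ltr_nat.
  by rewrite -[X in (X < _)%N]muln1 ltn_pmul2l // ltnW.
have /andP[k0 _] := frac k; have /andP[l0 _] := frac l.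
have /andP[k0' _] := frac k'; have /andP[l0' _] := frac l'.
(* Equal coarse cells make each [eta] nonnegative on the other point, so w_i and w_j are no further
   apart than the two points of the fine cell, against separation. *)
have ij : i = j.
  apply/eqP; apply/negPn/negP => /sep; rewrite leNgt => /negP; apply.
  apply: le_lt_trans close; rewrite ler_pM2l ?exprn_gt0 //.
  apply: supporting_dist => //; try exact: S_sphere; try by rewrite lerDl.
    exact: cj.
  by apply: ci => //; rewrite cell_ij.
subst j; suff [-> ->] : k = k' /\ l = l' by [].
have ww := S_sphere (Sw i); rewrite /sphere /= in ww Sei.
move: close; rewrite /pt !(dotvBl, dotvBr, dotvZl, dotvZr) (dotvC (eta _)) oi ww Sei.
set K := k%:R; set K' := k'%:R; set L := l%:R; set L' := l'%:R => close.
(* Now both offsets run along the orthonormal pair w_i, eta(w_i). *)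
have {close} close : (K - K') ^+ 2 + (L - L') ^+ 2 < 1.
  apply: le_lt_trans close; rewrite le_eqVlt; apply/orP; left; apply/eqP.
  by field; rewrite gt_eqF.
have := sqr_ge0 (K - K'); have := sqr_ge0 (L - L') => hL hK.
split; apply/val_inj/eqP/negPn/negP => /natr_sqr_sub_ge1; rewrite -/K -/L; lra.
Qed.

End SeparatedFamilies.

(** * Hausdorff dimension *)

Section HausdorffDimension.
Context {R : realType} {d : nat} (S : set 'rV[R]_d).
Implicit Types (v w x y : 'rV[R]_d).

Definition separated (n N : nat) (w : 'I_N -> 'rV[R]_d) :=
  (forall i, S (w i)) /\
  (forall i j, i != j -> 1 <= n%:R ^+ 2 * dotv (w i - w j) (w i - w j)).

(** The bound M makes a largest family exist; a point far from all its members could be appended to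
    it, at index [ord_max]. *)
Lemma maximal_separated (n M : nat) :
  (forall N (w : 'I_N -> 'rV[R]_d), separated n w -> (N <= M)%N) ->
  exists N (w : 'I_N -> 'rV[R]_d), separated n w /\
    forall x, S x -> exists i, n%:R ^+ 2 * dotv (x - w i) (x - w i) < 1.
Proof.
move=> bounded; pose P N := `[< exists w : 'I_N -> 'rV[R]_d, separated n w >].
have P0 : exists N, P N.
  exists 0%N; apply/asboolP; exists (fun=> 0); split; by case.
have PM N : P N -> (N <= M)%N by move=> /asboolP[w /bounded].
case: (ex_maxnP P0 PM) => N /asboolP[w [Sw sepw]] maxN.
exists N, w; split => // x Sx; apply: contrapT => /forallNP far.
have {}far i : 1 <= n%:R ^+ 2 * dotv (x - w i) (x - w i).
  by rewrite leNgt; exact/negP.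
suff : (N.+1 <= N)%N by rewrite ltnn.
apply: maxN; apply/asboolP.
exists (fun i => if unlift ord_max i is Some j then w j else x); split.
  by move=> i; case: unliftP => [j|] _.
move=> i j; case: unliftP => [i'|] ->; case: unliftP => [j'|] -> //.
- by rewrite (inj_eq lift_inj); exact: sepw.
- by move=> _; have := far i'; rewrite !dotv_sqrB (dotvC x) (addrC (dotv x x)).
- by rewrite eqxx.
Qed.

Lemma diam_pow_ge0 (s : R) (F : set 'rV[R]_d) : (0 <= diam_pow s F)%E.
Proof. by rewrite /diam_pow; case: pselect => ?; rewrite ?lee_fin ?powR_ge0. Qed.

(** For nonempty F the diameter lies in [0, c], so [fine] acts on a real number. *)
Lemma diam_pow_le (s c : R) (F : set 'rV[R]_d) : 0 <= s ->
  0 <= c -> (ediam F <= c%:E)%E -> (diam_pow s F <= (c `^ s)%:E)%E.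
Proof.
move=> s0 c0; rewrite /diam_pow; case: pselect => [? _|F0].
  by rewrite lee_fin powR_ge0.
have /set0P[x Fx] : F != set0 by exact/eqP.
have : (0 <= ediam F)%E.
  apply: ereal_sup_ubound; exists x => //; exists x => //.
  by rewrite /Defs.edist subrr dotv0r sqrtr0.
rewrite lee_fin; case: (ediam F) => // r; rewrite !lee_fin => r0 rc.
by rewrite ge0_ler_powR // nnegrE.
Qed.

(** Parallelogram law: |x - y|^2 <= 2|x - w|^2 + 2|y - w|^2. *)
Lemma ediam_ball (n : nat) w : (0 < n)%N ->
  (ediam [set x | n%:R ^+ 2 * dotv (x - w) (x - w) < 1]%R <= (2 / n%:R)%:E)%E.
Proof.
move=> n0; have n_gt0 : 0 < n%:R :> R by rewrite ltr0n.
apply: ge_ereal_sup => _ [x /= xw [y /= yw <-]]; rewrite lee_fin /Defs.edist.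
rewrite -[2 / n%:R]ger0_norm ?divr_ge0 // -sqrtr_sqr ler_wsqrtr //.
have := dotv_ge0 (x - w + (y - w)).
have -> : x - y = (x - w) - (y - w) by rewrite opprB addrA subrK.
rewrite dotv_sqrB dotv_sqrD exprMn exprVn ler_pdivlMr ?exprn_gt0 // => h.
by have := mulr_ge0 h (sqr_ge0 n%:R); lra.
Qed.

Lemma finite_nneseries_le (N : nat) (u : nat -> \bar R) (c : R) :
  (forall i, (0 <= u i)%E) -> (forall i, (u i <= c%:E)%E) ->
  (forall i, (N <= i)%N -> u i = 0%E) ->
  (\sum_(0 <= i <oo) u i <= (N%:R * c)%:E)%E.
Proof.
move=> u0 uc uN; apply: lime_le; first by apply: is_cvg_nneseries => i _ _.
exists N => // M /= NM.
rewrite (big_cat_nat _ NM) //= [X in (_ + X)%E]big_nat_cond [X in (_ + X)%E]big1 ?adde0; last first.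
  by move=> i /andP[/andP[Ni _] _]; exact: uN.
apply: (@le_trans _ _ (\sum_(0 <= i < N) c%:E)%E); first exact: lee_sum.
by rewrite sumEFin big_const_nat subn0 iter_addr_0 mulr_natl.
Qed.

Lemma hausdorff_content_ge0 (s delta : R) : (0 <= hausdorff_content s delta S)%E.
Proof.
apply: le_ereal_inf_tmp => _ [F _ <-]; apply: nneseries_ge0 => i _ _.
exact: diam_pow_ge0.
Qed.

Lemma hausdorff_content_le (s c delta : R) (N : nat) (F : 'I_N -> set 'rV[R]_d) :
  0 <= s -> 0 <= c -> c <= delta -> (forall x, S x -> exists i, F i x) ->
  (forall i, ediam (F i) <= c%:E)%E ->
  (hausdorff_content s delta S <= (N%:R * c `^ s)%:E)%E.
Proof.
move=> s0 c0 cd cov Fc.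
(* Padding by empty sets adds nothing, even for s = 0, and their diameter -oo meets the mesh
   bound. *)
pose G k : set 'rV[R]_d := if insub k is Some i then F i else set0.
have Gc k : (ediam (G k) <= c%:E)%E.
  rewrite /G; case: insubP => [i _ _|_]; first exact: Fc.
  by apply: ge_ereal_sup => _ [x []].
apply: ge_ereal_inf; exists (\sum_(0 <= k <oo) diam_pow s (G k))%E.
  exists G => //; split=> [x /cov[i Fx]|k].
    by exists (val i) => //; rewrite /G valK.
  by apply: le_trans (Gc k) _; rewrite lee_fin.
apply: finite_nneseries_le => k; [exact: diam_pow_ge0 | exact: diam_pow_le |].
by move=> Nk; rewrite /G insubF ?ltnNge ?Nk // /diam_pow; case: pselect.
Qed.

(* If every 1/n-separated family in S has O(n^(d-2)) members, then so do
   suitable covers by sets of diameter 2/n, and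
   n^(d-2) (2/n)^s -> 0 as soon as s > d-2. *)
Lemma hausdorff_dim_le (C : nat) : (1 < d)%N ->
  (forall n N (w : 'I_N -> 'rV[R]_d), (0 < n)%N -> separated n w ->
    (N * n ^ 2 <= C * n ^ d)%N) ->
  (hausdorff_dim S <= (d%:R - 2)%:E)%E.
Proof.
move=> d_gt1 sepC; have d2 : 2 <= d%:R :> R by rewrite ler_nat.
apply/lee_addgt0Pr => a a0; apply: ereal_inf_lbound.
exists (d%:R - 2 + a); last by rewrite EFinD.
set s := _ + a; have s0 : 0 <= s by rewrite /s; lra.
split => //; apply/eqP; rewrite eq_le; apply/andP; split; last first.
  apply: le_trans (hausdorff_content_ge0 s 1) _.
  by apply: ereal_sup_ubound; exists 1 => //=.
apply: ge_ereal_sup => _ [delta /= delta0 <-]; apply/lee_addgt0Pr => e e0.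
rewrite add0e; set K := C%:R * 2 `^ s.
have K0 : 0 <= K by rewrite mulr_ge0 ?powR_ge0.
(* Large enough that 2/n <= delta and K n^-a <= e. *)
pose n := (Num.truncn (Num.max (2 / delta) ((K / e) `^ a^-1))).+1.
have n_gt0 : 0 < n%:R :> R by rewrite ltr0n.
have [n1 n2] : 2 / delta <= n%:R /\ (K / e) `^ a^-1 <= n%:R.
  by apply/andP; rewrite -ge_max ltW // truncnS_gt.
have sepN N (w : 'I_N -> 'rV[R]_d) : separated n w -> (N <= C * n ^ (d - 2))%N.
  move=> /sepC - /(_ isT); rewrite -[in X in (_ <= X)%N -> _](subnK d_gt1) expnD mulnA.
  by rewrite leq_pmul2r ?expn_gt0.
have [N [w [sepw cov]]] := maximal_separated sepN.
have c0 : 0 <= 2 / n%:R :> R by rewrite divr_ge0.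
have cd : 2 / n%:R <= delta.
  by rewrite ler_pdivrMr // mulrC -ler_pdivrMr.
apply: le_trans (hausdorff_content_le s0 c0 cd cov (fun i => ediam_ball (w i) _)) _ => //.
rewrite lee_fin; apply: (@le_trans _ _ ((C * n ^ (d - 2))%:R * (2 / n%:R) `^ s)).
  by rewrite ler_wpM2r ?powR_ge0 // ler_nat (sepN _ w).
(* The exponents of n add up to d - 2 - s = -a. *)
have -> : (C * n ^ (d - 2))%:R * (2 / n%:R) `^ s = K * (n%:R `^ a)^-1 :> R.
  rewrite powRM ?invr_ge0 // -(powR_inv1 (ltW n_gt0)) -powRrM mulN1r.
  rewrite natrM natrX -powR_mulrn // natrB // /K -powRN.
  rewrite mulrACA; congr (_ * _).
  rewrite -powRD; last by rewrite (gt_eqF n_gt0) implybT.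
  by congr (_ `^ _); rewrite /s; lra.
have na : 0 < n%:R `^ a by rewrite powR_gt0.
rewrite ler_pdivrMr // mulrC -ler_pdivrMr //.
have <- : ((K / e) `^ a^-1) `^ a = K / e.
  by rewrite -powRrM mulVf ?gt_eqF // powRr1 // divr_ge0 // ltW.
by rewrite ge0_ler_powR ?nnegrE ?powR_ge0 // ltW.
Qed.

End HausdorffDimension.

Theorem theorem6p2 (R : realType) (d : nat) (hd : (2 <= d)%N)
  (mu : probability (borelRd R d) R) (hmu : on_sphere mu)
  (hmin : forall nu : probability (borelRd R d) R, on_sphere nu ->
            (frame_energy mu <= frame_energy nu)%E) :
  (hausdorff_dim (msupport mu) <= (d%:R - 2)%:E)%E.
Proof.
(* Minimality enters through comparison with the orthonormal competitor. *)
have small : (frame_energy mu <= (d%:R^-1 ^+ 2)%:E)%E.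
  by have [nu [/hmin le_nu <-]] := @exists_frame_energy_eq R d (ltnW hd).
(* The constant is the number (6d + 1)^d of coarse cells times the factor (7d)^d from the fine
   grid. *)
apply: (@hausdorff_dim_le _ _ _ (((6 * d).+1 * (7 * d)) ^ d)%N hd).
move=> n N w n_gt0 [Sw sepw].
apply: (separated_card hd _ _ _ n_gt0 Sw sepw).
- by move=> x; exact: msupport_sphere.
- by move=> x y z; exact: msupport_triple_ge0.
- by move=> x; exact: exists_msupport_orthogonal.
Qed.
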